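(* Let $2\le\sigma\le n$. Any algorithm solving $\mathrm{select}$ queries on a string $s\in[\sigma]^n$ using at most $t=o(\log\sigma)$ character probes (i.e. calls to $\mathrm{access}$) per query requires a succinct index with $r=\Omega\big(\frac{n\log\sigma}{t}\big)$ bits of redundancy.
   Context: $[\sigma]=\{0,\dots,\sigma-1\}$; logarithms are base 2. The string $s$ is read-only and can be read only through $\mathrm{access}(i)$, returning $s[i]$; each call is a probe. $\mathrm{select}(c,j)$ returns the position in $s$ of the $j$th occurrence of symbol $c$, or $-1$ if it does not exist. A succinct index is auxiliary information of $r$ bits (the redundancy, not counting the space to store $s$) computed from $s$ in a preprocessing step; the query algorithm may read the index but accesses $s$ only by probes, and $t$ is the maximum number of probes used to answer a query. The redundancy $r$ is the worst case over strings $s\in[\sigma]^n$. *)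

(* Defs.v *)
From HB Require Import structures.
From mathcomp Require Import all_boot all_order all_algebra.
From mathcomp Require Import all_classical all_reals all_analysis.

Set Implicit Arguments.
Unset Strict Implicit.
Unset Printing Implicit Defensive.

Import Order.TTheory GRing.Theory Num.Theory.
Import numFieldNormedType.Exports.

Local Open Scope ring_scope.

Definition log2 {R : realType} (x : R) : R := ln x / ln 2.

(* Positions are numbered from 0, occurrences from 1. *)
Definition select (sigma n : nat) (s : n.-tuple 'I_sigma) (c : 'I_sigma)
    (j : nat) : int :=
  let occ := [seq Posz (i : 'I_n) | i <- enum 'I_n & tnth s i == c] in
  if j is j'.+1 then nth (-1) occ j' else -1.

(* An adaptive query procedure: [Probe i k] calls access(i) and continues with
   [k] applied to the symbol read.  Computation between probes is free. *)
Inductive probe_tree (sigma n : nat) : Type :=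
| Answer of int
| Probe of 'I_n & ('I_sigma -> probe_tree sigma n).

Fixpoint run (sigma n : nat) (p : probe_tree sigma n) (s : n.-tuple 'I_sigma)
    : int :=
  match p with
  | Answer a => a
  | Probe i k => run (k (tnth s i)) s
  end.

Fixpoint probes (sigma n : nat) (p : probe_tree sigma n)
    (s : n.-tuple 'I_sigma) : nat :=
  match p with
  | Answer _ => 0
  | Probe i k => (probes (k (tnth s i)) s).+1
  end.

(* [query] sees the string only through the index and the probes; reading the
   index is free. *)
Record select_algorithm (sigma n : nat) : Type := SelectAlgorithm {
  index : n.-tuple 'I_sigma -> seq bool;
  query : seq bool -> 'I_sigma -> nat -> probe_tree sigma n
}.

Definition solves_select (sigma n : nat) (A : select_algorithm sigma n) : Prop :=
  forall (s : n.-tuple 'I_sigma) (c : 'I_sigma) (j : nat), (0 < j)%N ->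
    run (query A (index A s) c j) s = select s c j.

Definition uses_at_most (sigma n : nat) (A : select_algorithm sigma n)
    (t : nat) : Prop :=
  forall (s : n.-tuple 'I_sigma) (c : 'I_sigma) (j : nat), (0 < j)%N ->
    (probes (query A (index A s) c j) s <= t)%N.

Definition redundancy (sigma n : nat) (A : select_algorithm sigma n) : nat :=
  \max_(s : n.-tuple 'I_sigma) size (index A s).

(* Main.v *)
(* Restrict to strings cut into n / sigma blocks, each a permutation of the
   alphabet, so that select(c, b + 1) is the position of c in block b.  Fix the
   index and reveal such a string by running, again and again, a query whose
   answer is still unknown.  A query reveals at most t + 1 cells; each costs a
   factor sigma, except the answer cell, whose symbol is the queried one: it
   only costs its rank among the cells revealed, a factor at most t + 1.  So an
   index is shared by at most (sigma gamma)^N of these strings, where N is the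
   number of cells and gamma^(t + 1) = (t + 1) / sigma.  There are at least
   (sigma / 4)^N strings and fewer than 2^(r + 1) indices, hence
   r + 1 >= N (log (1 / gamma) - 2), which is of order n log sigma / t once
   log sigma / t exceeds a constant. *)

Require Import Defs.
From HB Require Import structures.
From mathcomp Require Import all_boot all_order all_algebra.
From mathcomp Require Import fingroup perm.
From mathcomp Require Import all_classical all_reals all_analysis.
From mathcomp Require Import ring lra zify.

Set Implicit Arguments.
Unset Strict Implicit.
Unset Printing Implicit Defensive.

Import Order.TTheory GRing.Theory Num.Theory.
Import numFieldNormedType.Exports.

Local Open Scope classical_set_scope.
Local Open Scope ring_scope.

(** * Counting strings compatible with the known cells, along a probe tree *)

Definition agree (n : nat) (S : finType) (D : {set 'I_n}) (v : 'I_n -> S)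
    (s : n.-tuple S) : bool := [forall (x | x \in D), tnth s x == v x].

Lemma agree_setU1 (n : nat) (S : finType) (D : {set 'I_n}) (v : 'I_n -> S)
    (i : 'I_n) (a : S) (s : n.-tuple S) :
  agree D v s -> tnth s i = a ->
  agree (i |: D) (fun x => if x == i then a else v x) s.
Proof.
move=> /forall_inP Hv Hi; apply/forall_inP => x; rewrite !inE.
by case: eqP => [->|_] /= ; [rewrite Hi | exact: Hv].
Qed.

Lemma card_setC_setU1 (n : nat) (D : {set 'I_n}) (i : 'I_n) :
  i \notin D -> #|~: D| = #|~: (i |: D)|.+1.
Proof.
move=> iD; rewrite (cardsD1 i (~: D)) finset.in_setC iD add1n; congr (_.+1).
by apply: eq_card => x; rewrite !inE negb_or.
Qed.

(* [gamma ^+ (_ - k.+1)] uses truncated subtraction: fewer than [k.+1] cells may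
   be left unknown.  The factor [sigma%:R] on the left is the one saved on the
   answer cell, and [k.+1] counts the steps at which that cell may show up.
   [K] is the set of cells lying in no block, whose content is known from the
   start. *)
Lemma card_query_tree (R : realFieldType) (sigma n : nat) (gamma : R)
    (B : 'I_n -> nat) (G : {set n.-tuple 'I_sigma}) (K : {set 'I_n})
    (c : 'I_sigma) (j N : nat) :
  0 <= gamma <= 1 ->
  (forall (D : {set 'I_n}) v, K \subset D -> (#|~: D| < N)%N ->
    #|[set s in G | agree D v s]|%:R <= (sigma%:R * gamma) ^+ #|~: D|) ->
  forall (p : probe_tree sigma n) (k : nat) (D : {set 'I_n}) v,
    K \subset D -> (#|~: D| <= N)%N ->
    (forall x, x \in D -> B x = j -> v x != c) ->
    sigma%:R * #|[set s in G | [&& agree D v s, (probes p s <= k)%N &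
      [exists i : 'I_n,
        [&& run p s == Posz i, tnth s i == c & B i == j]]]]|%:R
    <= k.+1%:R * sigma%:R ^+ #|~: D| * gamma ^+ (#|~: D| - k.+1).
Proof.
move=> /andP[g0 g1] IH.
have leg (a b : nat) : (a <= b)%N -> gamma ^+ b <= gamma ^+ a.
  by move=> ab; apply: ler_wiXn2l.
have s0 (e : nat) : 0 <= sigma%:R ^+ e :> R by apply: exprn_ge0.
(* Saving on the answer cell: its symbol must be [c], so it becomes known without a sum over
   symbols, and the factor [sigma%:R] on the left pays for the lost power of [sigma]. *)
have leafB (E : {set n.-tuple 'I_sigma}) (i : 'I_n) (D : {set 'I_n}) v k :
    K \subset D -> (#|~: D| <= N)%N -> i \notin D ->
    (forall s, s \in E -> s \in G /\ agree D v s /\ tnth s i = c) ->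
    sigma%:R * #|E|%:R <= sigma%:R ^+ #|~: D| * gamma ^+ (#|~: D| - k.+1).
  move=> KD uN iD HE.
  have uE := card_setC_setU1 iD.
  have := IH (i |: D) (fun x => if x == i then c else v x).
  move=> /(_ (fintype.subset_trans KD (finset.subsetUr _ _))).
  rewrite -uE => /(_ uN) H.
  have EH : #|E|%:R <= (sigma%:R * gamma) ^+ #|~: (i |: D)|.
    apply: le_trans H; rewrite ler_nat; apply: subset_leq_card.
    apply/fintype.subsetP => s /HE [sG [sA sc]]; rewrite inE sG /=.
    exact: agree_setU1.
  rewrite uE exprS -mulrA ler_wpM2l //.
  apply: le_trans EH _; rewrite exprMn ler_wpM2l //.
  by apply: leg; rewrite subSS leq_subr.
elim=> [a|i f IHf] k D v KD uN vD.
(* A leaf names one cell [i] for all its strings, and [vD] forces that cell to be still unknown, so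
   [leafB] applies. *)
- set E := [set _ in _ | _]%SET.
  have [->|[s0' s0E]] := set_0Vmem E.
    by rewrite cards0 mulr0 !mulr_ge0 ?exprn_ge0.
  move: (s0E); rewrite !inE => /and3P[_ sA].
  move=> /andP[_ /existsP[i /and3P[/eqP ai sc Bi]]].
  have iD : i \notin D.
    apply/negP => iD; move/forall_inP: sA => /(_ i iD) /eqP si.
    by have := vD i iD (eqP Bi); rewrite -si sc.
  have := @leafB E i D v k KD uN iD.
  move=> H; apply: le_trans (H _) _.
    move=> s; rewrite !inE => /and3P[sG sA'].
    move=> /andP[_ /existsP[i' /and3P[/eqP ai' sc' _]]].
    split=> //; split=> //; move: ai'; rewrite /= in ai *.
    rewrite ai => -[/val_inj ->].
    exact/eqP.
  rewrite -mulrA ler_peMl ?mulr_ge0 ?exprn_ge0 //.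
  by rewrite ler1n.
- case: k => [|k].
    set E := [set _ in _ | _]%SET; have -> : E = finset.set0.
      by apply/setP => s; rewrite !inE /= !andbF.
    by rewrite cards0 mulr0 !mulr_ge0 ?exprn_ge0.
  (* Probing a known cell follows a single branch: only the budget [k] drops. *)
  have [iD|iD] := boolP (i \in D).
    apply: le_trans
      (_ : k.+1%:R * sigma%:R ^+ #|~: D| * gamma ^+ (#|~: D| - k.+1) <= _);
      last first.
      apply: ler_pM; rewrite ?mulr_ge0 ?exprn_ge0 //.
        by rewrite ler_wpM2r // ler_nat.
      by apply: leg; lia.
    apply: le_trans (IHf (v i) k D v KD uN vD).
    rewrite ler_wpM2l // ler_nat; apply: subset_leq_card.
    apply/fintype.subsetP => s; rewrite !inE /= => /and3P[sG sA].
    move: (sA) => /forall_inP /(_ i iD) /eqP si; rewrite si ltnS => H.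
    by rewrite sG sA.
  have uE := card_setC_setU1 iD.
  set E := [set _ in _ | _]%SET.
  set u := #|~: (i |: D)| in uE *.
  have EE : #|E| = (\sum_(a : 'I_sigma) #|[set s in E | tnth s i == a]|)%N.
    rewrite -sum1_card (partition_big (fun s => tnth s i) predT) //=.
    by apply: eq_bigr => a _; rewrite -sum1_card; apply: eq_bigl => s; rewrite !inE.
  (* The induction hypothesis fails only in the branch that reads [c] in block [j], since the new
     cell then breaks the condition on [v]; [leafB] bounds that branch by the second term. Summed
     over [a], the two terms give the factors [k.+1] and [1] of [k.+2]. *)
  have Ha a : sigma%:R * #|[set s in E | tnth s i == a]|%:R <=
      k.+1%:R * sigma%:R ^+ u * gamma ^+ (u - k.+1) +
      (a == c)%:R * (sigma%:R ^+ u.+1 * gamma ^+ (u - k.+1)) :> R.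
    have t0 : 0 <= k.+1%:R * sigma%:R ^+ u * gamma ^+ (u - k.+1).
      by rewrite !mulr_ge0 ?exprn_ge0.
    have t1 : 0 <= (a == c)%:R * (sigma%:R ^+ u.+1 * gamma ^+ (u - k.+1)).
      by rewrite !mulr_ge0 ?exprn_ge0.
    have [/andP[/eqP ac /eqP Bi]|nres] := boolP ((a == c) && (B i == j)).
      apply: le_trans
        (_ : (a == c)%:R * (sigma%:R ^+ u.+1 * gamma ^+ (u - k.+1)) <= _);
        last by rewrite lerDr.
      rewrite ac eqxx mul1r -uE.
      apply: le_trans (@leafB _ i D v k.+1 KD uN iD _) _; last by rewrite uE subSS.
      by move=> s; rewrite !inE => /andP[/and3P[-> -> _] /eqP ->].
    apply: le_trans
      (_ : k.+1%:R * sigma%:R ^+ u * gamma ^+ (u - k.+1) <= _);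
      last by rewrite lerDl.
    have := IHf a k (i |: D) (fun x => if x == i then a else v x).
    move=> /(_ (fintype.subset_trans KD (finset.subsetUr _ _))).
    have uN' : (#|~: (i |: D)| <= N)%N by rewrite -ltnS -uE ltnW.
    move=> /(_ uN') H; apply: le_trans (H _).
      rewrite ler_wpM2l // ler_nat; apply: subset_leq_card.
      apply/fintype.subsetP => s; rewrite !inE /= => /andP[/and3P[sG sA] H'] /eqP si.
      rewrite sG agree_setU1 //=.
      by move: H'; rewrite si ltnS.
    move=> x; rewrite !inE; case: eqP => [-> _ Bi|_ /=]; last exact: vD.
    by move: nres; rewrite Bi eqxx andbT.
  rewrite EE natr_sum mulr_sumr.
  apply: le_trans (ler_sum _ (fun a _ => Ha a)) _.
  rewrite big_split /= sumr_const card_ord -mulr_suml (bigD1 c) //= eqxx.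
  rewrite big1 ?addr0; last by move=> a /negPf ->.
  rewrite uE subSS mul1r -mulr_natl exprS -[k.+2]addn1 natrD.
  by rewrite le_eqVlt; apply/orP; left; apply/eqP; ring.
Qed.

(** Strong induction on the number of unknown cells: one query with an unknown answer reveals cells
    at total cost [t.+1 / sigma], which the assumption on [gamma] bounds by [gamma ^+ t.+1]. *)
Lemma card_probe_solvable (R : realFieldType) (sigma n m t : nat) (gamma : R)
    (B : 'I_n -> nat) (T : 'I_sigma -> nat -> probe_tree sigma n)
    (G : {set n.-tuple 'I_sigma}) :
  (0 < sigma)%N -> 0 <= gamma <= 1 -> t.+1%:R <= sigma%:R * gamma ^+ t.+1 ->
  (forall s x y, s \in G -> (B x < m)%N -> B x = B y ->
    tnth s x = tnth s y -> x = y) ->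
  (forall s c j, s \in G -> (j < m)%N ->
    exists i : 'I_n, [/\ run (T c j) s = Posz i, tnth s i = c & B i = j]) ->
  (forall s c j, s \in G -> (probes (T c j) s <= t)%N) ->
  forall (D : {set 'I_n}) v, [set i | (m <= B i)%N]%SET \subset D ->
    #|[set s in G | agree D v s]|%:R <= (sigma%:R * gamma) ^+ #|~: D|.
Proof.
move=> sg0 g01 Hg Binj Trun Tprobe D v.
have /andP[g0 g1] := g01.
elim: {D}_.+1 {-2}D (ltnSn #|~: D|) v => // N IH D uN v KD.
set E := [set _ in _ | _]%SET.
have [->|[s sE]] := set_0Vmem E.
  by rewrite cards0 exprn_ge0 // mulr_ge0.
move: (sE); rewrite inE => /andP[sG sA].
(* The query is the one answered by [i] in [s], an arbitrary string compatible
   with [v]: no cell of [D] can answer it, in any such string. *)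
have [DT|[i iD]] := set_0Vmem (~: D).
  rewrite DT cards0 expr0 lern1; apply/card_le1_eqP => s1 s2.
  have aE x : x \in D by rewrite -[D]finset.setCK DT !inE.
  rewrite !inE => /andP[_ /forall_inP s1A] /andP[_ /forall_inP s2A].
  by apply: eq_from_tnth => x; rewrite (eqP (s1A x _)) ?(eqP (s2A x _)).
rewrite inE in iD.
have Bi : (B i < m)%N.
  rewrite ltnNge; apply: contra iD => Bi.
  by apply: (fintype.subsetP KD); rewrite inE.
have IH' (D' : {set 'I_n}) v' : [set i | (m <= B i)%N]%SET \subset D' ->
    (#|~: D'| < N)%N ->
    #|[set s in G | agree D' v' s]|%:R <= (sigma%:R * gamma) ^+ #|~: D'|.
  by move=> KD' uD'; apply: IH.
have := @card_query_tree R sigma n gamma B G _ (tnth s i) (B i) N g01 IH'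
  (T (tnth s i) (B i)) t D v KD uN.
set E' := [set _ in _ | _]%SET => HE'.
have EE' : E \subset E'.
  apply/fintype.subsetP => s'; rewrite !inE => /andP[s'G ->]; rewrite s'G Tprobe //=.
  have [x [rx sx Bx]] := Trun s' (tnth s i) (B i) s'G Bi.
  by apply/existsP; exists x; rewrite rx sx Bx !eqxx.
rewrite -(ler_pM2l (_ : 0 < sigma%:R)) ?ltr0n //.
apply: le_trans (_ : sigma%:R * #|E'|%:R <= _).
  by rewrite ler_wpM2l // ler_nat subset_leq_card.
apply: le_trans (HE' _) _.
  move=> x xD Bx; apply/eqP => vx.
  have sx : tnth s x = v x by apply/eqP; move/forall_inP: sA; apply.
  have ix : i = x by apply: (Binj s) => //; rewrite sx.
  by rewrite ix xD in iD.
set u := #|_|.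
apply: le_trans
  (_ : sigma%:R * gamma ^+ t.+1 * sigma%:R ^+ u * gamma ^+ (u - t.+1) <= _).
  by do 2!(apply: ler_wpM2r; first exact: exprn_ge0).
have -> : sigma%:R * gamma ^+ t.+1 * sigma%:R ^+ u * gamma ^+ (u - t.+1) =
    sigma%:R * (sigma%:R ^+ u * gamma ^+ (t.+1 + (u - t.+1))) by rewrite exprD; ring.
rewrite ler_wpM2l // exprMn ler_wpM2l ?exprn_ge0 //.
(* The exponent is the maximum of [u] and [t.+1]; as [gamma <= 1], it may be lowered to [u]. *)
by apply: ler_wiXn2l => //; lia.
Qed.

(** * Strings made of permutation blocks *)

Lemma select_count (sigma n : nat) (w : nat -> 'I_sigma) (q : 'I_n) :
  select [tuple w i | i < n] (w q)
    (count (fun i => w i == w q) (iota 0 q)).+1 = Posz q.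
Proof.
rewrite /select.
have -> : [seq Posz (i : 'I_n) |
    i <- enum 'I_n & tnth [tuple w i | i < n] i == w q] =
    map Posz [seq i <- iota 0 n | w i == w q].
  rewrite -val_enum_ord filter_map -map_comp; congr map.
  by apply: eq_filter => i /=; rewrite tnth_mktuple.
have -> : iota 0 n = iota 0 q ++ val q :: iota q.+1 (n - q.+1).
  have nE : n = (q + (n - q.+1).+1)%N by have := ltn_ord q; lia.
  by rewrite {1}nE iotaD.
rewrite filter_cat /= eqxx map_cat nth_cat size_map size_filter ltnn subnn.
by [].
Qed.

Section BlockStrings.
Context (k m n : nat).
Implicit Type p : {ffun 'I_m -> 'S_k.+1}.

(** Positions past the last block get the default [ord0], so their content is the same in every such
    string. *)
Definition block_symbol p (i : nat) : 'I_k.+1 :=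
  if insub (i %/ k.+1)%N is Some b then p b (inord (i %% k.+1)) else ord0.

Definition block_string p : n.-tuple 'I_k.+1 := [tuple block_symbol p i | i < n].

Lemma block_symbolE p (b : 'I_m) (x : 'I_k.+1) :
  block_symbol p (b * k.+1 + x) = p b x.
Proof.
rewrite /block_symbol divnMDl // divn_small // addn0 valK.
by rewrite modnMDl modn_small // inord_val.
Qed.

(** A permutation block contains [c] exactly once, at the preimage of [c]. *)
Lemma count_blocks p (c : 'I_k.+1) (b : nat) : (b <= m)%N ->
  count (fun i => block_symbol p i == c) (iota 0 (b * k.+1)) = b.
Proof.
elim: b => [//|b IH] bm.
rewrite mulSn addnC iotaD count_cat IH ?(ltnW bm) // -[RHS]addn1; congr (_ + _)%N.
rewrite add0n -[(b * k.+1)%N]addn0 iotaDl count_map -val_enum_ord count_map.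
have -> : 1%N = count_mem ((p (Ordinal bm))^-1%g c) (enum 'I_k.+1).
  by rewrite count_uniq_mem ?enum_uniq // mem_enum.
apply: eq_count => x /=; rewrite (block_symbolE p (Ordinal bm)).
by apply/eqP/eqP => [<-|->]; rewrite ?permK ?permKV.
Qed.

Lemma count_before p (b : 'I_m) (x : 'I_k.+1) :
  count (fun i => block_symbol p i == p b x) (iota 0 (b * k.+1 + x)) = b.
Proof.
rewrite iotaD count_cat count_blocks ?(ltnW (ltn_ord b)) // -[RHS]addn0.
congr (_ + _)%N; rewrite add0n -[(b * k.+1)%N]addn0 iotaDl count_map.
rewrite -[RHS](count_pred0 (iota 0 x)); apply: eq_in_count => y /=.
rewrite mem_iota add0n => /andP[_ yx].
have yk : (y < k.+1)%N by apply: ltn_trans (ltn_ord x).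
rewrite (block_symbolE p b (Ordinal yk)).
by apply/negP => /eqP /perm_inj /(congr1 val) /= xy; rewrite xy ltnn in yx.
Qed.

Context (mn : (m * k.+1 <= n)%N).

Lemma cell_lt (b : 'I_m) (x : 'I_k.+1) : (b * k.+1 + x < n)%N.
Proof.
apply: leq_trans mn; apply: leq_trans (_ : b.+1 * k.+1 <= _)%N.
  by rewrite mulSn addnC ltn_add2r.
by rewrite leq_mul2r ltn_ord orbT.
Qed.

Lemma tnth_block_string p (b : 'I_m) (x : 'I_k.+1) :
  tnth (block_string p) (Ordinal (cell_lt b x)) = p b x.
Proof. by rewrite tnth_mktuple /= block_symbolE. Qed.

Lemma select_block_string p (b : 'I_m) (x : 'I_k.+1) :
  select (block_string p) (p b x) b.+1 = Posz (b * k.+1 + x).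
Proof.
have := select_count (block_symbol p) (Ordinal (cell_lt b x)).
by rewrite /= block_symbolE count_before.
Qed.

Lemma block_string_inj : injective block_string.
Proof.
move=> p q pq; apply/ffunP => b; apply/permP => x.
by rewrite -!tnth_block_string pq.
Qed.

Lemma cellP (i : 'I_n) : (i %/ k.+1 < m)%N ->
  exists (b : 'I_m) (x : 'I_k.+1), i = Ordinal (cell_lt b x).
Proof.
move=> ib; exists (Ordinal ib), (Ordinal (ltn_pmod i (ltn0Sn k))).
by apply: val_inj; rewrite /= -divn_eq.
Qed.

Lemma div_cell (b : 'I_m) (x : 'I_k.+1) :
  (Ordinal (cell_lt b x) %/ k.+1)%N = b.
Proof. by rewrite /= divnMDl // divn_small // addn0. Qed.

Lemma card_cells : #|~: [set i : 'I_n | (m <= i %/ k.+1)%N]%SET| = (m * k.+1)%N.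
Proof.
have winj : injective (widen_ord mn) by move=> x y [] /val_inj.
rewrite -[RHS]card_ord -(card_imset predT winj).
apply: eq_card => i; rewrite !inE -ltnNge ltn_divLR //; apply/idP/imsetP.
  by move=> im; exists (Ordinal im) => //; apply: val_inj.
by move=> [x _ ->]; exact: (ltn_ord x).
Qed.

Lemma card_same_index (R : realFieldType) (t : nat) (gamma : R)
    (A : select_algorithm k.+1 n) (I : seq bool) :
  solves_select A -> uses_at_most A t ->
  0 <= gamma <= 1 -> t.+1%:R <= k.+1%:R * gamma ^+ t.+1 ->
  #|[set p | Defs.index A (block_string p) == I]%SET|%:R
    <= (k.+1%:R * gamma) ^+ (m * k.+1).
Proof.
move=> solveA probeA g01 Hg.
set P := [set p | _]%SET.
pose G := (block_string @: P)%SET.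
pose B (i : 'I_n) := (i %/ k.+1)%N.
have GP s : s \in G -> exists2 p, s = block_string p & Defs.index A s = I.
  by case/imsetP => p; rewrite inE => /eqP pI ->; exists p.
(* Fixing the index to [I] leaves one family of trees for all strings of [G]. Blocks are numbered
   from 0 and occurrences from 1, hence [j.+1]. *)
have := @card_probe_solvable R k.+1 n m t gamma B
  (fun c j => query A I c j.+1) G (ltn0Sn k) g01 Hg.
(* Initially the known cells are those outside the blocks, all holding [ord0]. *)
move=> H; have {}H := H _ _ _ [set i : 'I_n | (m <= B i)%N]%SET (fun=> ord0).
rewrite -card_cells; apply: le_trans (H _ _ _ _) => //.
- rewrite ler_nat -(card_imset _ block_string_inj) subset_leq_card //.
  apply/fintype.subsetP => s sG; rewrite inE sG /=.
  have [p -> _] := GP s sG; apply/forall_inP => i; rewrite inE /B => mi.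
  rewrite tnth_mktuple /block_symbol insubN // -leqNgt.
  exact: mi.
- move=> s x y sG xm; have [p -> _] := GP s sG => Bxy.
  have ym : (y %/ k.+1 < m)%N by rewrite -[(y %/ _)%N]Bxy.
  move: Bxy; rewrite /B; have [b [u ->]] := cellP xm; have [d [v ->]] := cellP ym.
  rewrite !div_cell => /val_inj ->; rewrite !tnth_block_string => /perm_inj ->.
  by [].
- move=> s c j sG jm; have [p sE sI] := GP s sG.
  pose b := Ordinal jm; pose x := (p b)^-1%g c.
  exists (Ordinal (cell_lt b x)); rewrite /B div_cell.
  have cE : c = p b x by rewrite permKV.
  split=> //; last by rewrite sE tnth_block_string -cE.
  by rewrite -sI solveA // sE {1}cE (select_block_string p b x).
- by move=> s c j sG; have [p _ sI] := GP s sG; rewrite -sI probeA.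
Qed.

End BlockStrings.

(** * From shared indices to a bound on the redundancy *)

Lemma card_bounded_words (R : realFieldType) (T : finType) (g : T -> seq bool)
    (M : R) (r : nat) (E : {set T}) :
  (forall x, x \in E -> (size (g x) <= r)%N) ->
  (forall w, #|[set x in E | g x == w]%SET|%:R <= M) ->
  #|E|%:R <= (2 ^+ r.+1 - 1) * M.
Proof.
elim: r g E => [|r IH] g E Hs HM.
  rewrite expr1 (_ : 2 - 1 = 1) ?mul1r; last by ring.
  apply: le_trans (HM [::]); rewrite ler_nat subset_leq_card //.
  apply/fintype.subsetP => x xE; rewrite inE xE /=.
  by rewrite -size_eq0 -leqn0; exact: Hs.
(* Splitting on the first bit matches the word count [1 + 2 * (2 ^ r.+1 - 1) = 2 ^ r.+2 - 1]. *)
pose E' b := [set x in E | ohead (g x) == Some b]%SET.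
have HE' b : #|E' b|%:R <= (2 ^+ r.+1 - 1) * M.
  apply: (IH (behead \o g)).
    move=> x; rewrite inE => /andP[xE _] /=; rewrite size_behead.
    by have := Hs x xE; case: (size _).
  move=> w; apply: le_trans (HM (b :: w)); rewrite ler_nat subset_leq_card //.
  apply/fintype.subsetP => x; rewrite !inE /= => /andP[/andP[-> ]].
  by case: (g x) => //= a l /eqP[->] /eqP ->.
have EU : E \subset [set x in E | g x == [::]]%SET :|: (E' true :|: E' false).
  apply/fintype.subsetP => x xE; rewrite !inE xE /=.
  by case: (g x) => [|[] l].
have : (#|E| <= #|[set x in E | g x == [::]]%SET| + (#|E' true| + #|E' false|))%N.
  apply: leq_trans (subset_leq_card EU) _.
  apply: leq_trans (leq_card_setU _ _) _; rewrite leq_add2l.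
  exact: leq_card_setU.
rewrite -(ler_nat R) !natrD => H; apply: le_trans H _.
have := HM [::]; have := HE' true; have := HE' false.
rewrite [in X in _ -> _ -> _ -> X]exprS; set X := 2 ^+ r.+1.
by move: (_%:R) (_%:R) (_%:R) => x y z; lra.
Qed.

Lemma expnn_le_fact (n : nat) : (n ^ n <= 4 ^ n * n`!)%N.
Proof.
(* [n ^ n <= 2n (2n - 1) ... (n + 1) = 'C(2n, n) n! <= 4 ^ n n!] *)
apply: leq_trans (_ : n.*2 ^_ n <= _)%N.
  rewrite ffact_prod -[X in (X ^ n)%N]/n -{2}[n]card_ord -prod_nat_const.
  by apply: leq_prod => i _; have := ltn_ord i; lia.
rewrite -bin_ffact leq_mul2r; apply/orP; right.
rewrite (_ : 4 ^ n = 2 ^ n.*2)%N; last by rewrite -mul2n expnM.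
rewrite -[2%N]/(1 + 1)%N expnDn.
have nn : (n < n.*2.+1)%N by lia.
by rewrite (bigD1 (Ordinal nn)) //= !exp1n !muln1 leq_addr.
Qed.

(** The [sigma! ^ m] block strings number at least [(sigma / 4) ^ (m * sigma)], with
    [m = n %/ sigma]; comparing this with the number of indices times the strings sharing one, the
    powers of [sigma] cancel. *)
Lemma redundancy_ge (R : realFieldType) (sigma n t : nat) (gamma : R)
    (A : select_algorithm sigma n) :
  (0 < sigma)%N -> solves_select A -> uses_at_most A t ->
  0 <= gamma <= 1 -> t.+1%:R <= sigma%:R * gamma ^+ t.+1 ->
  1 <= 2 ^+ (redundancy A).+1 * (4 * gamma) ^+ (n %/ sigma * sigma).
Proof.
case: sigma A => [//|k] A _ solveA probeA g01 Hg.
set r := redundancy A; set m := (n %/ k.+1)%N.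
have mn : (m * k.+1 <= n)%N by rewrite leq_trunc_div.
have g0 : 0 <= gamma by case/andP: g01.
set M := (k.+1%:R * gamma) ^+ (m * k.+1).
have : #|[set: {ffun 'I_m -> 'S_k.+1}]%SET|%:R <= (2 ^+ r.+1 - 1) * M.
  apply: (@card_bounded_words _ _ (fun p => Defs.index A (block_string n p))).
    by move=> p _; exact: (leq_bigmax (block_string n p)).
  move=> w; apply: le_trans (card_same_index mn w solveA probeA g01 Hg).
  rewrite ler_nat subset_leq_card //.
  by apply/fintype.subsetP => p; rewrite !inE.
rewrite cardsT card_ffun card_ord card_Sn natrX => H.
have k0 : 0 < k.+1%:R ^+ (m * k.+1) :> R by rewrite exprn_gt0 // ltr0n.
rewrite -(ler_pM2l k0) mulr1.
apply: le_trans (_ : 4 ^+ (m * k.+1) * (k.+1)`!%:R ^+ m <= _).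
  rewrite -!natrX -natrM ler_nat [(m * _)%N]mulnC !expnM -expnMn.
  by case: (m) => // m'; rewrite leq_exp2r // expnn_le_fact.
apply: le_trans (_ : 4 ^+ (m * k.+1) * ((2 ^+ r.+1 - 1) * M) <= _).
  by rewrite ler_wpM2l // exprn_ge0.
rewrite /M !exprMn.
set a := 4 ^+ _; set b := gamma ^+ _; set c := k.+1%:R ^+ _; set d := 2 ^+ _.
rewrite (mulrCA c d) (mulrCA c a) (mulrCA d a).
rewrite ler_wpM2l ?exprn_ge0 // ler_wpM2r ?mulr_ge0 ?exprn_ge0 //; lra.
Qed.

(** * Explicit constants and the asymptotic statement *)

Lemma select_redundancy (R : realType) (sigma n t : nat)
    (A : select_algorithm sigma n) :
  (2 <= sigma <= n)%N -> (0 < t)%N -> solves_select A -> uses_at_most A t ->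
  t%:R <= 16^-1 * log2 (sigma%:R : R) ->
  n%:R * log2 (sigma%:R : R) / t%:R <= 32 * (redundancy A)%:R.
Proof.
move=> /andP[sigma2 sigman] t0 solveA probeA; rewrite /log2.
set L := ln sigma%:R; set l := ln 2 => tL.
have l1 : 1/2 <= l.
  have := @le_ln1Dx R (-(1/2)); rewrite (_ : 1 + - (1/2) = 2^-1 :> R); last by field.
  rewrite lnV ?posrE // -/l => H; have : -1 < -(1/2) :> R by lra.
  by move=> /H; lra.
have l0 : 0 < l by lra.
have t1 : 1 <= t%:R :> R by rewrite ler1n.
have tpos : 0 < t%:R :> R by rewrite ltr0n.
set X := L / l / t%:R.
have LE : L = X * (l * t%:R) by rewrite /X; field; rewrite !gt_eqF.
have X16 : 16 <= X by rewrite /X ler_pdivlMr //; lra.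
have sE : sigma%:R = expR L by rewrite lnK // posrE ltr0n; apply: ltn_trans sigma2.
(* This is [sigma] to the power [-1 / (4 t)], a value for which [Hg] follows from [1 + x <= expR x]
   and [X >= 16]. *)
pose gamma := expR (- (X * l / 4)) : R.
have Xl : 0 <= X * l by rewrite mulr_ge0 //; lra.
have g01 : 0 <= gamma <= 1.
  by rewrite expR_ge0 /= -expR0 ler_expR; lra.
have Hg : t.+1%:R <= sigma%:R * gamma ^+ t.+1.
  rewrite sE -expRM_natl -expRD.
  have Y : 16 * (1/2) * t%:R <= X * l * t%:R.
    by apply: ler_wpM2r; [exact: ltW | apply: ler_pM; lra].
  have Z : X * l * 1 <= X * l * t%:R by rewrite ler_wpM2l.
  apply: le_trans (expR_ge1Dx _).
  rewrite -[t.+1%:R]natr1 LE.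
  move: Y Z; rewrite (mulrA X l); set W := X * l * t%:R; set V := X * l => Y Z.
  rewrite (_ : _ * - (V / 4) = - (W / 4) - V / 4); last by rewrite /W -/V; field.
  lra.
have := redundancy_ge (ltnW sigma2) solveA probeA g01 Hg.
set r := redundancy A; set N := (n %/ sigma * sigma)%N.
(* The incomplete block has fewer than [sigma] cells, and [sigma <= N]. *)
have nN : n%:R <= 2 * N%:R :> R.
  rewrite -natrM ler_nat mul2n -addnn /N {1}(divn_eq n sigma) leq_add2l.
  apply: leq_trans (ltnW (ltn_pmod _ (ltnW sigma2))) _.
  by rewrite leq_pmull // divn_gt0 // ltnW.
have n2 : 2 <= n%:R :> R by rewrite ler_nat (leq_trans sigma2).
have e2 : 2 = expR l :> R by rewrite lnK // posrE.
have -> : 4 * gamma = expR (2 * l - X * l / 4).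
  by rewrite expRD (_ : 2 * l = l + l) ?expRD -?e2; [congr (_ * _)|]; ring.
rewrite [X in X ^+ r.+1]e2 -!expRM_natl -expRD -[leLHS]expR0 ler_expR => H.
have {}H : 0 <= l * (r.+1%:R - N%:R * (X / 4 - 2)) by apply: le_trans H _; lra.
have {}H : 0 <= r.+1%:R - N%:R * (X / 4 - 2) by rewrite pmulr_rge0 in H.
(* [X >= 16] gives [X / 4 - 2 >= X / 8], so [r + 1 >= n X / 16]; then [n X >= 32] absorbs the [1]
   and leaves [r >= n X / 32]. *)
have NX : n%:R / 2 * (X / 8) <= N%:R * (X / 4 - 2).
  by apply: ler_pM; lra.
have nX : 2 * 16 <= n%:R * X by apply: ler_pM; lra.
move: H; rewrite -natr1.
rewrite (_ : n%:R * _ / _ = n%:R * X); last by rewrite /X; ring.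
lra.
Qed.

(* The parameters n and sigma, the algorithm and its probe bound t vary with an
   index i, and the asymptotic notation refers to an arbitrary filter F on the
   indices. *)
Theorem theorem3 (R : realType) (I : Type) (F : filter_on I)
    (n sigma t : I -> nat)
    (A : forall i : I, select_algorithm (sigma i) (n i)) :
  (\forall i \near F, (2 <= sigma i <= n i)%N) ->
  (\forall i \near F, (0 < t i)%N) ->
  (\forall i \near F, solves_select (A i)) ->
  (\forall i \near F, uses_at_most (A i) (t i)) ->
  (fun i : I => (t i)%:R : R) =o_F (fun i : I => log2 (sigma i)%:R : R) ->
  (fun i : I => (redundancy (A i))%:R : R) =Omega_F
    (fun i : I => (n i)%:R * log2 (sigma i)%:R / (t i)%:R : R).
Proof.
move=> Hsigma Ht Hsolve Hprobe /eqoP Ho.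
(* The witness [1/32] and the little-o threshold [1/16] are the constants of [select_redundancy]. *)
rewrite eqOmegaE qualifE; apply/asboolP; exists 32^-1; first by rewrite invr_gt0.
have e0 : 0 < 16^-1 :> R by rewrite invr_gt0.
have := Ho _ e0.
apply: filter_app; apply: filter_app Hprobe; apply: filter_app Hsolve.
apply: filter_app Ht; apply: filterS Hsigma => i sn t0 solveA probeA.
have log0 : 0 <= log2 (sigma i)%:R :> R.
  have /andP[s2 _] := sn.
  by rewrite divr_ge0 ?ln_ge0 ?ler1n // ltnW.
have q0 : 0 <= (n i)%:R * log2 (sigma i)%:R / (t i)%:R :> R.
  by apply: divr_ge0 => //; exact: mulr_ge0.
rewrite (ger0_norm log0) (ger0_norm q0) !ger0_norm // => tL.
by rewrite ler_pdivrMl //; exact: select_redundancy.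
Qed.
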